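(* Let $IP$ be a mixed-integer linear program and let $\mathtt{cert}$ be a VIPR certificate for $IP$, with all notation as in the context. Then $\mathtt{cert}$ is valid if and only if the predicate $\phi \triangleq \phi_{SOL}\wedge\phi_{DER}$ evaluates to $\mathtt{true}$.
   Context: Setting. $IP$ is a mixed-integer linear program with variables $x=(x_1,\dots,x_n)$, index set $I\subseteq[n]$ of integer variables, objective vector $c\in\mathbb{R}^n$, sense $\mathtt{sense}(IP)\in\{\mathtt{min},\mathtt{max}\}$ and constraints $C_1,\dots,C_m$. A constraint $C$ is given by a coefficient vector $a\in\mathbb{R}^n$, a right-hand side $b\in\mathbb{R}$ and a sign $s(C)\in\{-1,0,1\}$; it reads $a\cdot x\ge b$ if $s(C)=1$, $a\cdot x=b$ if $s(C)=0$, $a\cdot x\le b$ if $s(C)=-1$. Write $l(C)=a\cdot x$, $r(C)=b$, and for $C_i$ write $a_{i,j}$, $b_i$. A VIPR certificate $\mathtt{cert}$ for $IP$ consists of: a relation to prove $RTP$, which is either $\mathtt{infeasible}$ or a pair $(lb,ub)$ with $lb\in\mathbb{R}\cup\{-\infty\}$, $ub\in\mathbb{R}\cup\{+\infty\}$; a finite set $SOL\subseteq\mathbb{R}^n$; and derived constraints $C_{m+1},\dots,C_d$. Each derived constraint $C_k$ has a reason $\mathtt{reason}(C_k)\in\{\mathtt{asm},\mathtt{lin},\mathtt{rnd},\mathtt{uns},\mathtt{sol}\}$, data $\mathtt{data}(C_k)$ and an assumption set $\mathtt{A}(C_k)\subseteq S$, where $S=\{i\in\{m+1,\dots,d\}:\mathtt{reason}(C_i)=\mathtt{asm}\}$.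 If the reason is $\mathtt{lin}$ or $\mathtt{rnd}$, $\mathtt{data}(C_k)=(\mathtt{data}(C_k)_i)_{i\in[d]}$ is a real vector with support $\mathtt{nz}(\mathtt{data}(C_k))=\{i:\mathtt{data}(C_k)_i\ne0\}$; if the reason is $\mathtt{uns}$, $\mathtt{data}(C_k)=(i_1,l_1,i_2,l_2)\in[d]^4$. For original constraints, $\mathtt{A}(C_i)=\emptyset$ ($i\le m$). Domination. A constraint with coefficients $a$, rhs $b$, sign $s$ is an absurdity if $a=0$ and ($s=0,b\ne0$) or ($s=1,b>0$) or ($s=-1,b<0$). It dominates a constraint with coefficients $a'$, rhs $b'$, sign $s'$ if it is an absurdity, or $a=a'$ and: if $s'=0$ then $s=0$ and $b=b'$; if $s'=1$ then $s\in\{0,1\}$ and $b\ge b'$; if $s'=-1$ then $s\in\{0,-1\}$ and $b\le b'$. Linear combinations. For $\lambda\in\mathbb{R}^d$ with support $N$, $\sum_{i\in N}\lambda_iC_i$ has coefficients $(\sum_{i\in N}\lambda_ia_{i,j})_{j\in[n]}$, rhs $\sum_{i\in N}\lambda_ib_i$, and sign $0$ if $\lambda_is(C_i)=0$ for all $i\in N$; otherwise sign $1$ if $\lambda_is(C_i)\ge0$ for all $i\in N$, sign $-1$ if $\lambda_is(C_i)\le0$ for all $i\in N$; otherwise its sign is undefined and it dominates nothing. A constraint is roundable if its sign is $\pm1$, its coefficients are integers at indices in $I$ and zero outside $I$; its rounding replaces $b$ by $\lceil b\rceil$ (sign $1$) or $\lfloor b\rfloor$ (sign $-1$). Constraints $C_i,C_j$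 form a split disjunction if they have the same coefficient vector $a$ with $a_t\in\mathbb{Z}$ for $t\in I$ and $a_t=0$ for $t\notin I$, $b_i,b_j\in\mathbb{Z}$, their signs are nonzero and opposite, and $b_i=b_j+1$ if $s(C_i)=1$, $b_i=b_j-1$ if $s(C_i)=-1$. Validity. $sol\in\mathbb{R}^n$ is feasible if $sol_j\in\mathbb{Z}$ for $j\in I$ and $sol$ satisfies $C_1,\dots,C_m$. $\mathtt{cert}$ is SOL-valid if: when $RTP=\mathtt{infeasible}$, $SOL=\emptyset$; otherwise all elements of $SOL$ are feasible, and if $\mathtt{sense}(IP)=\mathtt{min}$ and $ub\ne\infty$ then $c\cdot sol\le ub$ for some $sol\in SOL$, while if $\mathtt{sense}(IP)=\mathtt{max}$ and $lb\ne-\infty$ then $c\cdot sol\ge lb$ for some $sol\in SOL$. A derived constraint $C_k$ is valid if: ($\mathtt{asm}$) $\mathtt{A}(C_k)=\{k\}$; ($\mathtt{lin}$) $\mathtt{nz}(\mathtt{data}(C_k))\subseteq[k-1]$, $\mathtt{A}(C_k)=\bigcup_{i\in\mathtt{nz}(\mathtt{data}(C_k))}\mathtt{A}(C_i)$, and $\sum_i\mathtt{data}(C_k)_iC_i$ dominates $C_k$; ($\mathtt{rnd}$) the same, except that the combination must be roundable and its rounding must dominate $C_k$; ($\mathtt{uns}$, data $(i_1,l_1,i_2,l_2)$) $i_1,l_1,i_2,l_2<k$, $C_{i_1}$ and $C_{i_2}$ each dominate $C_k$, $C_{l_1},C_{l_2}$ form a split disjunction, and $\mathtt{A}(C_k)=(\mathtt{A}(C_{i_1})\setminus\{l_1\})\cup(\mathtt{A}(C_{i_2})\setminus\{l_2\})$;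 ($\mathtt{sol}$) $\mathtt{A}(C_k)=\emptyset$ and for some $sol\in SOL$ the constraint $c\cdot x\le c\cdot sol$ (if min) resp. $c\cdot x\ge c\cdot sol$ (if max) dominates $C_k$. $\mathtt{cert}$ is DER-valid if every derived constraint is valid and: if $RTP=\mathtt{infeasible}$, $C_d$ dominates $0\cdot x\ge1$ and $\mathtt{A}(C_d)=\emptyset$; otherwise, if min and $lb\ne-\infty$ then $C_d$ dominates $c\cdot x\ge lb$ and $\mathtt{A}(C_d)=\emptyset$, and if max and $ub\ne\infty$ then $C_d$ dominates $c\cdot x\le ub$ and $\mathtt{A}(C_d)=\emptyset$. $\mathtt{cert}$ is valid if it is SOL-valid and DER-valid. Predicates. $P$ is the truth value of $\mathtt{sense}(IP)=\mathtt{min}$; $R$ that of $RTP\ne\mathtt{infeasible}$; $PUB=R\wedge(ub\ne\infty)$, $PLB=R\wedge(lb\ne-\infty)$; $U=ub$ if $PUB$ and $0$ otherwise; $L=lb$ if $PLB$ and $0$ otherwise. $A_k^j$ is the truth value of $j\in\mathtt{A}(C_k)$; $S_{<k}=\{j\in S:j<k\}$, $S_{>k}=\{j\in S:j>k\}$. $\phi_{FEAS}=\bigwedge_{sol\in SOL}\big[\bigwedge_{j\in I}(sol_j\in\mathbb{Z})\wedge\bigwedge_{i\in[m]}\big((s(C_i)\ge0\Rightarrow \sum_ja_{i,j}sol_j\ge b_i)\wedge(s(C_i)\le0\Rightarrow\sum_ja_{i,j}sol_j\le b_i)\big)\big]$. $\phi_{SOL}$: if $\neg R$ then $|SOL|=0$,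 else $\phi_{FEAS}\wedge$ (if $P$ then $(PUB\Rightarrow\bigvee_{sol\in SOL}c\cdot sol\le U)$ else $(PLB\Rightarrow\bigvee_{sol\in SOL}c\cdot sol\ge L)$). $\phi_{DOM}(a,b,eq,geq,leq,a',b',eq',geq',leq')$ for $a,a'\in\mathbb{R}^n$, $b,b'\in\mathbb{R}$, Booleans $eq,\dots,leq'$: $\big[\bigwedge_j(a_j=0)\wedge(\text{if }eq\text{ then }b\ne0\text{ else if }geq\text{ then }b>0\text{ else if }leq\text{ then }b<0\text{ else false})\big]\vee\big[\bigwedge_j(a_j=a'_j)\wedge(\text{if }eq'\text{ then }(eq\wedge b=b')\text{ else if }geq'\text{ then }(geq\wedge b\ge b')\text{ else if }leq'\text{ then }(leq\wedge b\le b')\text{ else false})\big]$. For constraints $C,C'$, $\phi_{DOM}(C,C')$ means $\phi_{DOM}(a,r(C),s(C)=0,s(C)\ge0,s(C)\le0,a',r(C'),s(C')=0,s(C')\ge0,s(C')\le0)$. $\phi_{ASM}(k)$ ($m<k\le d$) is $\bigwedge_{j\in S_{>k}}\neg A_k^j$ conjoined with: if $\mathtt{asm}$: $A_k^k\wedge\bigwedge_{j\in S_{<k}}\neg A_k^j$; if $\mathtt{lin}$ or $\mathtt{rnd}$: $\bigwedge_{j\in S_{<k}}\big(A_k^j=\bigvee_{i\in\mathtt{nz}(\mathtt{data}(C_k)),\,j\le i<k}A_i^j\big)$; if $\mathtt{uns}$ with data $(i_1,l_1,i_2,l_2)$: $\bigwedge_{j\in S_{<k}}\big(A_k^j=(A_{i_1}^j\wedge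 j\ne l_1)\vee(A_{i_2}^j\wedge j\ne l_2)\big)$; if $\mathtt{sol}$: $\bigwedge_{j\in S_{<k}}\neg A_k^j$. $\phi_{PRV}(k)=\bigwedge_{j\in\mathtt{nz}(\mathtt{data}(C_k))}(j<k)$. $\phi_{RND}(a,b,eq)=\bigwedge_{j\in I}(a_j\in\mathbb{Z})\wedge\bigwedge_{j\notin I}(a_j=0)\wedge\neg eq$. $\phi_{DIS}(i,j)=\bigwedge_{t\in[n]}(a_{i,t}=a_{j,t})\wedge\bigwedge_{t\in I}(a_{i,t}\in\mathbb{Z})\wedge\bigwedge_{t\notin I}(a_{i,t}=0)\wedge(b_i\in\mathbb{Z})\wedge(b_j\in\mathbb{Z})\wedge(s(C_i)\ne0\wedge s(C_i)+s(C_j)=0)\wedge(\text{if }s(C_i)=1\text{ then }b_i=b_j+1\text{ else }b_i=b_j-1)$. For $\mathtt{lin}/\mathtt{rnd}$ constraints, with $N=\mathtt{nz}(\mathtt{data}(C_k))$, $\lambda=\mathtt{data}(C_k)$: $eq=\bigwedge_{i\in N}(\lambda_is(C_i)=0)$, $geq=\bigwedge_{i\in N}(\lambda_is(C_i)\ge0)$, $leq=\bigwedge_{i\in N}(\lambda_is(C_i)\le0)$, $A=(\sum_{i\in N}\lambda_ia_{i,j})_{j\in[n]}$, $B=\sum_{i\in N}\lambda_ib_i$. $\phi_{DER}(k)$: ($\mathtt{asm}$) $\phi_{ASM}(k)$; ($\mathtt{lin}$) $\phi_{ASM}(k)\wedge\phi_{PRV}(k)\wedge\phi_{DOM}(A,B,eq,geq,leq,(a_{k,j})_j,b_k,s(C_k)=0,s(C_k)\ge0,s(C_k)\le0)$;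 ($\mathtt{rnd}$) $\phi_{ASM}(k)\wedge\phi_{PRV}(k)\wedge\phi_{RND}(A,B,eq)\wedge\big(\big[\bigwedge_j(A_j=0)\wedge(\text{if }geq\text{ then }B>0\text{ else if }leq\text{ then }B<0\text{ else false})\big]\vee\big[\bigwedge_j(A_j=a_{k,j})\wedge(\text{if }s(C_k)=0\text{ then false else if }s(C_k)=1\text{ then }(geq\wedge\lceil B\rceil\ge b_k)\text{ else }(leq\wedge\lfloor B\rfloor\le b_k))\big]\big)$; ($\mathtt{uns}$) $\phi_{ASM}(k)\wedge(k>i_1)\wedge(k>i_2)\wedge(k>l_1)\wedge(k>l_2)\wedge\phi_{DOM}(C_{i_1},C_k)\wedge\phi_{DOM}(C_{i_2},C_k)\wedge\phi_{DIS}(l_1,l_2)$; ($\mathtt{sol}$) $\phi_{ASM}(k)\wedge$ (if $P$ then $\bigvee_{sol\in SOL}\phi_{DOM}(c\cdot x\le c\cdot sol,C_k)$ else $\bigvee_{sol\in SOL}\phi_{DOM}(c\cdot x\ge c\cdot sol,C_k)$). $\phi_{DER}=\big(\bigwedge_{m<k\le d}\phi_{DER}(k)\big)\wedge$ (if $\neg R$ then $(\phi_{DOM}(C_d,0\cdot x\ge1)\wedge\bigwedge_{j\in S}\neg A_d^j)$ else $\big((P\wedge PLB)\Rightarrow(\phi_{DOM}(C_d,c\cdot x\ge L)\wedge\bigwedge_{j\in S}\neg A_d^j)\big)\wedge\big((\neg P\wedge PUB)\Rightarrow(\phi_{DOM}(C_d,c\cdot x\le U)\wedge\bigwedge_{j\in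 S}\neg A_d^j)\big)$). *)

(* Defs.v *)
From HB Require Import structures.
From mathcomp Require Import all_boot all_order all_algebra.
From mathcomp Require Import finmap.
From mathcomp Require Import reals constructive_ereal.

Set Implicit Arguments.
Unset Strict Implicit.
Unset Printing Implicit Defensive.

Import Order.TTheory GRing.Theory Num.Theory.
Local Open Scope ring_scope.

Variant sense := Min | Max.

Variant sign := SGe | SEq | SLe.

Definition int_of_sign (s : sign) : int :=
  match s with SGe => 1 | SEq => 0 | SLe => -1 end.

Definition dot (R : realType) (n : nat) (a x : 'rV[R]_n) : R :=
  \sum_(j < n) a 0 j * x 0 j.

Record constr (R : realType) (n : nat) := Constr {
  coef : 'rV[R]_n;
  rhs : R;
  csign : sign
}.

Definition sg (R : realType) (n : nat) (C : constr R n) : int :=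
  int_of_sign (csign C).

Record milp (R : realType) (n m : nat) := Milp {
  msense : sense;
  obj : 'rV[R]_n;
  ivars : {set 'I_n};
  cons : 'I_m -> constr R n
}.

(* The constructor arguments of [Bounds] express that the lower bound lies in
   R \cup {-oo} and the upper bound in R \cup {+oo}. *)
Variant rel_to_prove (R : realType) :=
  | Infeasible
  | Bounds (lb ub : \bar R) of lb != +oo%E & ub != -oo%E.
Arguments Infeasible {R}.

Variant reason (R : realType) (d : nat) :=
  | Asm
  | Lin of 'rV[R]_d
  | Rnd of 'rV[R]_d
  | Uns of 'I_d & 'I_d & 'I_d & 'I_d (* i1, l1, i2, l2 *)
  | Sol.
Arguments Asm {R d}.
Arguments Sol {R d}.

Definition is_asm (R : realType) (d : nat) (r : reason R d) : bool :=
  if r is Asm then true else false.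

(* With m original and q derived constraints, d = m + q.  Indices are counted
   from 0: [lshift q i] is the (i+1)-st original constraint and [rshift m k] is
   the (k+1)-st derived one. *)
Definition asm_idx (R : realType) (m q : nat)
    (rs : 'I_q -> reason R (m + q)) : {set 'I_(m + q)} :=
  [set i | if split i is inr k then is_asm (rs k) else false].

Record certificate (R : realType) (n m q : nat) := Certificate {
  rtp : rel_to_prove R;
  sols : {fset 'rV[R]_n};
  der : 'I_q -> constr R n;
  rsn : 'I_q -> reason R (m + q);
  der_asms : 'I_q -> {set 'I_(m + q)};
  der_asms_sub : forall k, der_asms k \subset asm_idx rsn
}.

Section Vipr.
Variables (R : realType) (n m q : nat).
Local Notation d := (m + q)%N.
Variables (IP : milp R n m) (cert : certificate R n m q).

Definition constraint (i : 'I_d) : constr R n :=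
  match split i with inl i0 => cons IP i0 | inr k => der cert k end.

Definition asms (i : 'I_d) : {set 'I_d} :=
  match split i with inl _ => set0 | inr k => der_asms cert k end.

Definition nz (lam : 'rV[R]_d) : {set 'I_d} := [set i | lam 0 i != 0].

Definition lc_coef (lam : 'rV[R]_d) : 'rV[R]_n :=
  \row_j \sum_(i in nz lam) lam 0 i * coef (constraint i) 0 j.

Definition lc_rhs (lam : 'rV[R]_d) : R :=
  \sum_(i in nz lam) lam 0 i * rhs (constraint i).

Definition lc_eq (lam : 'rV[R]_d) : bool :=
  [forall i in nz lam, lam 0 i * (sg (constraint i))%:~R == 0].

Definition lc_geq (lam : 'rV[R]_d) : bool :=
  [forall i in nz lam, lam 0 i * (sg (constraint i))%:~R >= 0].

Definition lc_leq (lam : 'rV[R]_d) : bool :=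
  [forall i in nz lam, lam 0 i * (sg (constraint i))%:~R <= 0].

Definition lc_sign (lam : 'rV[R]_d) : option sign :=
  if lc_eq lam then Some SEq
  else if lc_geq lam then Some SGe
  else if lc_leq lam then Some SLe
  else None.

Definition lincomb (lam : 'rV[R]_d) : option (constr R n) :=
  omap (Constr (lc_coef lam) (lc_rhs lam)) (lc_sign lam).

Definition satisfies (x : 'rV[R]_n) (C : constr R n) : Prop :=
  match csign C with
  | SGe => dot (coef C) x >= rhs C
  | SEq => dot (coef C) x = rhs C
  | SLe => dot (coef C) x <= rhs C
  end.

Definition feasible (x : 'rV[R]_n) : Prop :=
  (forall j, j \in ivars IP -> x 0 j \is a Num.int) /\
  (forall i, satisfies x (cons IP i)).

Definition absurdity (C : constr R n) : Prop :=
  coef C = 0 /\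
  [\/ sg C = 0 /\ rhs C <> 0, sg C = 1 /\ rhs C > 0 | sg C = -1 /\ rhs C < 0].

Definition dominates (C C' : constr R n) : Prop :=
  absurdity C \/
  (coef C = coef C' /\
   [/\ sg C' = 0 -> sg C = 0 /\ rhs C = rhs C',
       sg C' = 1 -> (sg C = 0 \/ sg C = 1) /\ rhs C >= rhs C' &
       sg C' = -1 -> (sg C = 0 \/ sg C = -1) /\ rhs C <= rhs C']).

Definition int_coefs (a : 'rV[R]_n) : Prop :=
  (forall j, j \in ivars IP -> a 0 j \is a Num.int) /\
  (forall j, j \notin ivars IP -> a 0 j = 0).

Definition roundable (C : constr R n) : Prop :=
  (sg C = 1 \/ sg C = -1) /\ int_coefs (coef C).

(* The value for sign 0 is irrelevant: such constraints are not roundable. *)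
Definition rounding (C : constr R n) : constr R n :=
  let b := match csign C with
           | SGe => (Num.ceil (rhs C))%:~R
           | SEq => rhs C
           | SLe => (Num.floor (rhs C))%:~R
           end in
  Constr (coef C) b (csign C).

Definition split_disjunction (C C' : constr R n) : Prop :=
  [/\ coef C = coef C' /\ int_coefs (coef C),
      rhs C \is a Num.int /\ rhs C' \is a Num.int,
      sg C <> 0 /\ sg C = - sg C',
      (sg C = 1 -> rhs C = rhs C' + 1) &
      (sg C = -1 -> rhs C = rhs C' - 1)].

Definition sol_constr (x : 'rV[R]_n) : constr R n :=
  Constr (obj IP) (dot (obj IP) x)
    (match msense IP with Min => SLe | Max => SGe end).

Definition valid_der (k0 : 'I_q) : Prop :=
  let k := rshift m k0 in
  let Ck := constraint k in
  match rsn cert k0 with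
  | Asm => asms k = [set k]
  | Lin lam =>
      [/\ (forall i, i \in nz lam -> (i < k)%N),
          asms k = \bigcup_(i in nz lam) asms i &
          exists2 C, lincomb lam = Some C & dominates C Ck]
  | Rnd lam =>
      [/\ (forall i, i \in nz lam -> (i < k)%N),
          asms k = \bigcup_(i in nz lam) asms i &
          exists2 C, lincomb lam = Some C &
            roundable C /\ dominates (rounding C) Ck]
  | Uns i1 l1 i2 l2 =>
      [/\ [/\ (i1 < k)%N, (l1 < k)%N, (i2 < k)%N & (l2 < k)%N],
          dominates (constraint i1) Ck /\ dominates (constraint i2) Ck,
          split_disjunction (constraint l1) (constraint l2) &
          asms k = (asms i1 :\ l1) :|: (asms i2 :\ l2)]
  | Sol =>
      asms k = set0 /\
      exists2 x, x \in sols cert & dominates (sol_constr x) Ck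
  end.

(* C_d dominates C and has no assumptions; this is false when d = 0. *)
Definition last_proves (C : constr R n) : Prop :=
  exists k : 'I_d,
    [/\ k.+1 = d, dominates (constraint k) C & asms k = set0].

Definition sol_valid : Prop :=
  match rtp cert with
  | Infeasible => sols cert = fset0
  | Bounds lb ub _ _ =>
      [/\ (forall x, x \in sols cert -> feasible x),
          (msense IP = Min -> ub <> +oo%E ->
             exists2 x, x \in sols cert & ((dot (obj IP) x)%:E <= ub)%E) &
          (msense IP = Max -> lb <> -oo%E ->
             exists2 x, x \in sols cert & (lb <= (dot (obj IP) x)%:E)%E)]
  end.

Definition der_valid : Prop :=
  (forall k, valid_der k) /\
  match rtp cert with
  | Infeasible => last_proves (Constr 0 1 SGe)
  | Bounds lb ub _ _ =>
      (msense IP = Min -> lb <> -oo%E ->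
         last_proves (Constr (obj IP) (fine lb) SGe)) /\
      (msense IP = Max -> ub <> +oo%E ->
         last_proves (Constr (obj IP) (fine ub) SLe))
  end.

Definition valid : Prop := sol_valid /\ der_valid.

Definition pP : bool := if msense IP is Min then true else false.

Definition pR : bool := if rtp cert is Bounds _ _ _ _ then true else false.

Definition pPUB : bool :=
  if rtp cert is Bounds _ ub _ _ then ub != +oo%E else false.

Definition pPLB : bool :=
  if rtp cert is Bounds lb _ _ _ then lb != -oo%E else false.

Definition bU : R :=
  if rtp cert is Bounds _ ub _ _ then (if pPUB then fine ub else 0) else 0.

Definition bL : R :=
  if rtp cert is Bounds lb _ _ _ then (if pPLB then fine lb else 0) else 0.

Definition asmS : {set 'I_d} := asm_idx (rsn cert).

Definition phi_feas : bool :=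
  all (fun x : 'rV[R]_n =>
    [forall j in ivars IP, x 0 j \is a Num.int] &&
    [forall i : 'I_m,
       ((sg (cons IP i) >= 0) ==>
          (\sum_(j < n) coef (cons IP i) 0 j * x 0 j >= rhs (cons IP i))) &&
       ((sg (cons IP i) <= 0) ==>
          (\sum_(j < n) coef (cons IP i) 0 j * x 0 j <= rhs (cons IP i)))])
    (sols cert).

Definition phi_sol : bool :=
  if ~~ pR then #|` sols cert| == 0%N
  else phi_feas &&
    (if pP then pPUB ==> has (fun x => dot (obj IP) x <= bU) (sols cert)
     else pPLB ==> has (fun x => dot (obj IP) x >= bL) (sols cert)).

Definition phi_dom (a : 'rV[R]_n) (b : R) (eq geq leq : bool)
    (a' : 'rV[R]_n) (b' : R) (eq' geq' leq' : bool) : bool :=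
  ([forall j, a 0 j == 0] &&
     (if eq then b != 0 else if geq then b > 0
      else if leq then b < 0 else false)) ||
  ([forall j, a 0 j == a' 0 j] &&
     (if eq' then eq && (b == b') else if geq' then geq && (b >= b')
      else if leq' then leq && (b <= b') else false)).

Definition phi_domc (C C' : constr R n) : bool :=
  phi_dom (coef C) (rhs C) (sg C == 0) (sg C >= 0) (sg C <= 0)
          (coef C') (rhs C') (sg C' == 0) (sg C' >= 0) (sg C' <= 0).

Definition phi_asm (k0 : 'I_q) : bool :=
  let k := rshift m k0 in
  let none_below := [forall j in asmS, (j < k)%N ==> (j \notin asms k)] in
  let lin_asm (lam : 'rV[R]_d) :=
    [forall j in asmS, (j < k)%N ==>
       ((j \in asms k) ==
          [exists i in nz lam, (j <= i < k)%N && (j \in asms i)])] in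
  [forall j in asmS, (k < j)%N ==> (j \notin asms k)] &&
  match rsn cert k0 with
  | Asm => (k \in asms k) && none_below
  | Lin lam => lin_asm lam
  | Rnd lam => lin_asm lam
  | Uns i1 l1 i2 l2 =>
      [forall j in asmS, (j < k)%N ==>
         ((j \in asms k) ==
            ((j \in asms i1) && (j != l1)) || ((j \in asms i2) && (j != l2)))]
  | Sol => none_below
  end.

Definition phi_prv (k : 'I_d) (lam : 'rV[R]_d) : bool :=
  [forall j in nz lam, (j < k)%N].

Definition phi_rnd (a : 'rV[R]_n) (b : R) (eq : bool) : bool :=
  [&& [forall j in ivars IP, a 0 j \is a Num.int],
      [forall j, (j \notin ivars IP) ==> (a 0 j == 0)] & ~~ eq].

Definition phi_dis (i j : 'I_d) : bool :=
  let Ci := constraint i in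
  let Cj := constraint j in
  [&& [forall t, coef Ci 0 t == coef Cj 0 t],
      [forall t in ivars IP, coef Ci 0 t \is a Num.int],
      [forall t, (t \notin ivars IP) ==> (coef Ci 0 t == 0)],
      rhs Ci \is a Num.int, rhs Cj \is a Num.int,
      sg Ci != 0, sg Ci + sg Cj == 0 &
      if sg Ci == 1 then rhs Ci == rhs Cj + 1 else rhs Ci == rhs Cj - 1].

Definition phi_der_at (k0 : 'I_q) : bool :=
  let k := rshift m k0 in
  let Ck := constraint k in
  match rsn cert k0 with
  | Asm => phi_asm k0
  | Lin lam =>
      [&& phi_asm k0, phi_prv k lam &
          phi_dom (lc_coef lam) (lc_rhs lam)
                  (lc_eq lam) (lc_geq lam) (lc_leq lam)
                  (coef Ck) (rhs Ck) (sg Ck == 0) (sg Ck >= 0) (sg Ck <= 0)]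
  | Rnd lam =>
      let A := lc_coef lam in
      let B := lc_rhs lam in
      [&& phi_asm k0, phi_prv k lam, phi_rnd A B (lc_eq lam) &
          ([forall j, A 0 j == 0] &&
             (if lc_geq lam then B > 0
              else if lc_leq lam then B < 0 else false)) ||
          ([forall j, A 0 j == coef Ck 0 j] &&
             (if sg Ck == 0 then false
              else if sg Ck == 1 then
                lc_geq lam && ((Num.ceil B)%:~R >= rhs Ck)
              else lc_leq lam && ((Num.floor B)%:~R <= rhs Ck)))]
  | Uns i1 l1 i2 l2 =>
      [&& phi_asm k0, (i1 < k)%N, (i2 < k)%N, (l1 < k)%N, (l2 < k)%N,
          phi_domc (constraint i1) Ck, phi_domc (constraint i2) Ck &
          phi_dis l1 l2]
  | Sol =>
      phi_asm k0 &&
      (if pP then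
         has (fun x => phi_domc (Constr (obj IP) (dot (obj IP) x) SLe) Ck)
             (sols cert)
       else
         has (fun x => phi_domc (Constr (obj IP) (dot (obj IP) x) SGe) Ck)
             (sols cert))
  end.

(* As for [last_proves], false when d = 0. *)
Definition phi_last (C : constr R n) : bool :=
  [exists k : 'I_d, [&& k.+1 == d, phi_domc (constraint k) C &
                        [forall j in asmS, j \notin asms k]]].

Definition phi_der : bool :=
  [forall k, phi_der_at k] &&
  (if ~~ pR then phi_last (Constr 0 1 SGe)
   else ((pP && pPLB) ==> phi_last (Constr (obj IP) bL SGe)) &&
        ((~~ pP && pPUB) ==> phi_last (Constr (obj IP) bU SLe))).

Definition phi : bool := phi_sol && phi_der.

End Vipr.

(* Main.v *)
(* Constraint by constraint, each conjunct of the predicate decides the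
   corresponding validity clause.  The one global ingredient is the assumption
   sets: the predicate compares A(C_k) with the prescribed set only at indices
   j < k and, for linear combinations, only through the A(C_i) with j <= i.
   Nothing is lost because A(C_i) contains no index above i, which is enforced
   directly by the predicate and follows from validity by strong induction. *)
Require Import Defs.
From mathcomp Require Import all_boot all_order all_algebra reals.
From mathcomp Require Import finmap constructive_ereal.

Set Implicit Arguments.
Unset Strict Implicit.
Unset Printing Implicit Defensive.

Import Order.TTheory GRing.Theory Num.Theory.
Local Open Scope ring_scope.

(** * Coefficient vectors and domination *)

Lemma forall_row_eqE (R : realType) (n : nat) (a b : 'rV[R]_n) :
  [forall j, a 0 j == b 0 j] = (a == b).
Proof.
apply/forallP/eqP => [ab | -> //].
by apply/rowP => j; apply/eqP.
Qed.

Lemma forall_row_eq0E (R : realType) (n : nat) (a : 'rV[R]_n) :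
  [forall j, a 0 j == 0] = (a == 0).
Proof.
by rewrite -forall_row_eqE; apply: eq_forallb => j; rewrite mxE.
Qed.

(** Both cascades test sign 0 first, so a later branch concerns a strict sign only. In contrast, the
    flags [geq] and [leq] of the dominating constraint are weak: [sg C >= 0] says at once that the
    sign is 0 or 1, which is what a target of sign 1 allows. What remains is a check of the nine
    pairs of signs. *)
Lemma dominatesP (R : realType) (n : nat) (C C' : constr R n) :
  reflect (dominates C C') (phi_domc C C').
Proof.
rewrite /phi_domc /phi_dom forall_row_eqE forall_row_eq0E.
case: C C' => a b s [a' b' s'] /=.
apply: (iffP orP) => -[].
- move=> /andP[/eqP a0]; rewrite /dominates /absurdity /sg /= => h; left.
  split=> //; case: s h => /= h.
  + by apply: Or32.
  + by apply: Or31; split=> //; apply/eqP.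
  + by apply: Or33.
- move=> /andP[/eqP aa]; rewrite /dominates /sg /= => h; right.
  split=> //; move: h.
  case: s s' => -[] //= h; split=> // _; split=> //; try exact/eqP; by [left | right].
- rewrite /absurdity /sg /= => -[-> h]; left; rewrite eqxx /=.
  by case: s h => /= -[] [] // _ /eqP.
- rewrite /sg /= => -[-> h]; right; rewrite eqxx /=.
  case: s s' h => -[] //= [h0 h1 h2];
  by [ case: (h0 erefl) => // _ ->; rewrite eqxx
     | case: (h1 erefl) => -[] // _ ->
     | case: (h2 erefl) => -[] // _ -> ].
Qed.

(** * Linear combinations, rounding and split disjunctions *)

Section Correctness.
Variables (R : realType) (n m q : nat).
Local Notation d := (m + q)%N.
Variables (IP : milp R n m) (cert : certificate R n m q).
Implicit Types (lam : 'rV[R]_d) (i j : 'I_d) (k : 'I_q).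

Local Notation constraint := (constraint IP cert).
Local Notation asms := (asms cert).
Local Notation asmS := (asmS cert).

(** This leaves four cases for the pair ([geq], [leq]): three behave like the sign flags of a
    genuine constraint, and the fourth is the undefined sign. *)
Lemma lc_eqE lam : lc_eq IP cert lam = lc_geq IP cert lam && lc_leq IP cert lam.
Proof.
apply/idP/andP => [/forall_inP h | [/forall_inP hg /forall_inP hl]].
  by split; apply/forall_inP => i /h /eqP ->.
by apply/forall_inP => i hi; rewrite eq_le hg // hl.
Qed.

Lemma lincomb_dominatesP lam (C' : constr R n) :
  (exists2 C, lincomb IP cert lam = Some C & dominates C C') <->
  phi_dom (lc_coef IP cert lam) (lc_rhs IP cert lam)
    (lc_eq IP cert lam) (lc_geq IP cert lam) (lc_leq IP cert lam)
    (coef C') (rhs C') (sg C' == 0) (sg C' >= 0) (sg C' <= 0).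
Proof.
rewrite /lincomb /lc_sign lc_eqE.
set A := lc_coef _ _ _; set B := lc_rhs _ _ _.
have dom s : (exists2 C, omap (Constr A B) (Some s) = Some C & dominates C C')
    <-> phi_domc (Constr A B s) C'.
  by split=> [[C [<-] /dominatesP] | /dominatesP] //=; exists (Constr A B s).
case: (lc_geq _ _ _); case: (lc_leq _ _ _); rewrite /=.
- exact: (dom SEq).
- exact: (dom SGe).
- exact: (dom SLe).
(* Undefined sign: no combination exists, and since all three flags are false every branch of
   [phi_dom] is false as well. *)
split=> [[] // |]; rewrite /phi_dom /= andbF /=.
by case: ifP; rewrite ?andbF //; case: ifP; rewrite ?andbF //; case: ifP; rewrite andbF.
Qed.

Lemma int_coefsP (a : 'rV[R]_n) :
  reflect (int_coefs IP a)
    ([forall j in ivars IP, a 0 j \is a Num.int] &&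
     [forall j, (j \notin ivars IP) ==> (a 0 j == 0)]).
Proof.
apply: (iffP andP) => -[hi h0]; split.
- exact/forall_inP.
- by move=> j hj; apply/eqP; have /forall_inP := h0; apply.
- exact/forall_inP.
- by apply/forall_inP => j /h0 ->.
Qed.

(** The predicate tests absurdity on the unrounded [B]. This is the same test as on the rounding,
    because 0 is an integer: the ceiling of [B] is positive iff [B] is, and the floor is negative
    iff [B] is. If both flags hold, the sign is 0 and the combination is not roundable, in agreement
    with [~~ eq]. *)
Lemma rounding_dominatesP lam (C' : constr R n) :
  (exists2 C, lincomb IP cert lam = Some C &
     roundable IP C /\ dominates (rounding C) C') <->
  let A := lc_coef IP cert lam in
  let B := lc_rhs IP cert lam in
  phi_rnd IP A B (lc_eq IP cert lam) &&
  (([forall j, A 0 j == 0] &&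
     (if lc_geq IP cert lam then B > 0
      else if lc_leq IP cert lam then B < 0 else false)) ||
   ([forall j, A 0 j == coef C' 0 j] &&
     (if sg C' == 0 then false
      else if sg C' == 1 then
        lc_geq IP cert lam && ((Num.ceil B)%:~R >= rhs C')
      else lc_leq IP cert lam && ((Num.floor B)%:~R <= rhs C')))).
Proof.
rewrite /lincomb /lc_sign /phi_rnd lc_eqE /=.
set A := lc_coef _ _ _; set B := lc_rhs _ _ _.
have rnd s : s <> SEq ->
    (exists2 C, omap (Constr A B) (Some s) = Some C &
       roundable IP C /\ dominates (rounding C) C') <->
    [forall j in ivars IP, A 0 j \is a Num.int] &&
    [forall j, (j \notin ivars IP) ==> (A 0 j == 0)] &&
    phi_domc (rounding (Constr A B s)) C'.
  move=> sN0; split.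
    by move=> [C [<-]] [[_ /int_coefsP ->] /dominatesP].
  case/andP => /int_coefsP hA /dominatesP hd.
  exists (Constr A B s) => //; split=> //; split=> //.
  by case: s sN0 {hd} => //; [left | right].
rewrite (forall_row_eqE A (coef C')) (forall_row_eq0E A).
case: (lc_geq _ _ _); case: (lc_leq _ _ _); rewrite /= ?andbT ?andbF.
- split=> [[C [<-]] [[[]]] // | //].
- apply: (iff_trans (rnd SGe _)) => //.
  rewrite /phi_domc /phi_dom /= forall_row_eqE forall_row_eq0E.
  rewrite ltr0z ceil_gt0 -!andbA.
  by case: C' {rnd} => a' b' [] /=.
- apply: (iff_trans (rnd SLe _)) => //.
  rewrite /phi_domc /phi_dom /= forall_row_eqE forall_row_eq0E.
  rewrite ltrz0 floor_lt0 -!andbA.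
  by case: C' {rnd} => a' b' [] /=.
split=> [[] // |].
by case: C' {rnd} => a' b' [] /=; rewrite ?andbF.
Qed.

Lemma split_disjunctionP i j :
  reflect (split_disjunction IP (constraint i) (constraint j))
    (phi_dis IP cert i j).
Proof.
rewrite /phi_dis forall_row_eqE.
case: (constraint i) (constraint j) => a b s [a' b' s'] /=.
rewrite /split_disjunction /=.
apply: (iffP idP).
  case/and5P => /eqP <- hI h0 -> /and4P[-> hs hss hb].
  have /int_coefsP hA : [forall t in ivars IP, a 0 t \is a Num.int] &&
    [forall t, (t \notin ivars IP) ==> (a 0 t == 0)] by rewrite hI.
  split=> //.
  - by split; [exact/eqP | apply/eqP; rewrite -addr_eq0 hss].
  - by move=> h; move: hb; rewrite h eqxx => /eqP.
  - by move=> h; move: hb; rewrite h => /eqP.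
case=> -[<- /int_coefsP /andP[-> ->]] [-> ->] [/eqP hs /eqP].
rewrite -addr_eq0 => -> /=.
(* Sign 0 being excluded by [hs], the else branch of the predicate is exactly sign -1. *)
by rewrite eqxx hs; case: s hs => //= _ hge hle; apply/eqP; [exact: hge | exact: hle].
Qed.

(** * Assumption sets *)

Lemma asms_sub i : asms i \subset asmS.
Proof.
rewrite /Defs.asms; case: (split i) => [_|k]; first exact: sub0set.
exact: der_asms_sub.
Qed.

Lemma mem_asmS_rshift k : (rshift m k \in asmS) = is_asm (rsn cert k).
Proof. by rewrite inE -[rshift m k]/(unsplit (inr k)) unsplitK. Qed.

Lemma asms_lshift (i : 'I_m) : asms (lshift q i) = set0.
Proof. by rewrite /Defs.asms -[lshift q i]/(unsplit (inl i)) unsplitK. Qed.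

Lemma asms_eq0P i :
  reflect (asms i = set0) [forall j in asmS, j \notin asms i].
Proof.
apply: (iffP forall_inP) => [h | -> j _]; last by rewrite inE.
apply/setP => j; rewrite in_set0; apply/negP => ji.
by have := h j (subsetP (asms_sub i) j ji); rewrite ji.
Qed.

(** Four ranges of indices are treated separately. Outside [asmS] neither set has elements; below k
    membership is compared directly; above k both sets are empty, by the first conjunct and by the
    bound on [X]; and k itself is not in [asmS], its reason not being [Asm]. *)
Lemma asms_eqP k (X : {set 'I_d}) :
  ~~ is_asm (rsn cert k) -> X \subset asmS ->
  (forall j, j \in X -> (j < rshift m k)%N) ->
  reflect (asms (rshift m k) = X)
    ([forall j in asmS, (rshift m k < j)%N ==> (j \notin asms (rshift m k))] &&
     [forall j in asmS, (j < rshift m k)%N ==>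
        ((j \in asms (rshift m k)) == (j \in X))]).
Proof.
move=> kN XS Xlt; apply: (iffP andP) => [[/forall_inP ha /forall_inP hb] | ->].
  apply/setP => j; case jS: (j \in asmS); last first.
    rewrite (contraFF (subsetP (asms_sub _) j) jS).
    by rewrite (contraFF (subsetP XS j) jS).
  case: (ltngtP j (rshift m k)) => [lt_jk | lt_kj | /val_inj jk].
  - by have /implyP/(_ lt_jk)/eqP := hb j jS.
  - have /implyP/(_ lt_kj)/negPf -> := ha j jS.
    by apply/esym/negP => /Xlt; rewrite ltnNge ltnW.
  - by move: jS; rewrite jk mem_asmS_rshift (negPf kN).
split; apply/forall_inP => j _; apply/implyP => // lt_kj.
by apply/negP => /Xlt; rewrite ltnNge ltnW.
Qed.

Definition asms_bounded := forall i j, j \in asms i -> (j <= i)%N.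

(** The first conjunct of [phi_asm] forbids assumptions above k within [asmS], and [asms_sub] leaves
    no others. *)
Lemma asms_bounded_phi : (forall k, phi_asm cert k) -> asms_bounded.
Proof.
move=> hphi i j; have jS := subsetP (asms_sub i) j.
case: (split_ordP i) jS => [i0 -> | k -> jS ji]; first by rewrite asms_lshift inE.
have /andP[/forall_inP/(_ j (jS ji))/implyP h _] := hphi k.
by rewrite leqNgt; apply/negP => /h; rewrite ji.
Qed.

(** An assumption constraint assumes only itself; any other derived constraint has no assumptions or
    inherits them from constraints of smaller index, where the induction hypothesis applies. *)
Lemma asms_bounded_valid : (forall k, valid_der IP cert k) -> asms_bounded.
Proof.
move=> hval i; have [b] := ubnP (nat_of_ord i); elim: b i => // b IHb i.
case: (split_ordP i) => [i0 -> _ j | k -> ltkb j]; first by rewrite asms_lshift inE.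
have IH i1 : (i1 < rshift m k)%N -> j \in asms i1 -> (j <= rshift m k)%N.
  move=> lt_i1k ji1; apply: leq_trans (ltnW lt_i1k).
  by apply: IHb ji1; apply: leq_trans lt_i1k _.
have := hval k; rewrite /valid_der; case: (rsn cert k) => [|lam|lam|i1 l1 i2 l2|].
- by move=> ->; rewrite inE => /eqP ->.
- by case=> lt_nz -> _ /bigcupP[i1 /lt_nz]; apply: IH.
- by case=> lt_nz -> _ /bigcupP[i1 /lt_nz]; apply: IH.
- case=> -[lt1 _ lt2 _] _ _ ->; rewrite !inE.
  by case/orP => /andP[_]; apply: IH.
- by case=> -> _; rewrite inE.
Qed.

Lemma phi_asm_sol k : rsn cert k = Sol ->
  reflect (asms (rshift m k) = set0) (phi_asm cert k).
Proof.
move=> rk; rewrite /phi_asm rk.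
(* Absence of assumptions is recast as agreement with the empty set, to fit [asms_eqP]. *)
have -> : [forall j in asmS, (j < rshift m k)%N ==> (j \notin asms (rshift m k))]
  = [forall j in asmS, (j < rshift m k)%N ==>
      ((j \in asms (rshift m k)) == (j \in set0))].
  by apply: eq_forallb_in => j _; rewrite in_set0 eqbF_neg.
by apply: asms_eqP; rewrite ?rk ?sub0set // => j; rewrite inE.
Qed.

(** Here k belongs to [asmS], so [asms_eqP] does not apply; the index k is settled by the explicit
    conjunct [k \in asms k] instead. *)
Lemma phi_asm_asm k : rsn cert k = Asm ->
  reflect (asms (rshift m k) = [set rshift m k]) (phi_asm cert k).
Proof.
move=> rk; rewrite /phi_asm rk.
apply: (iffP and3P) => [[/forall_inP ha kk /forall_inP hb] | ->].
  apply/setP => j; rewrite inE.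
  case jS: (j \in asmS); last first.
    rewrite (contraFF (subsetP (asms_sub _) j) jS).
    by apply/esym/negP => /eqP jk; move: jS; rewrite jk mem_asmS_rshift rk.
  rewrite -val_eqE /=; case: (ltngtP j (rshift m k)) => [lt_jk|lt_kj|/val_inj ->//].
  - by have /implyP/(_ lt_jk)/negPf := hb j jS.
  - by have /implyP/(_ lt_kj)/negPf := ha j jS.
rewrite set11; split=> //; apply/forall_inP => j _; apply/implyP => jk;
  by rewrite inE; apply: contraTneq jk => ->; rewrite ltnn.
Qed.

Section Bounded.
Hypothesis bounded : asms_bounded.

(** Boundedness makes the restriction [j <= i] automatic, so the existential is membership in the
    union. It also places the union strictly below k, as [asms_eqP] requires. *)
Lemma lin_asms_eqP k lam : ~~ is_asm (rsn cert k) ->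
  (forall i, i \in nz lam -> (i < rshift m k)%N) ->
  reflect (asms (rshift m k) = \bigcup_(i in nz lam) asms i)
    ([forall j in asmS, (rshift m k < j)%N ==> (j \notin asms (rshift m k))] &&
     [forall j in asmS, (j < rshift m k)%N ==>
        ((j \in asms (rshift m k)) ==
           [exists i in nz lam, (j <= i < rshift m k)%N && (j \in asms i)])]).
Proof.
move=> kN lt_nz.
have -> : [forall j in asmS, (j < rshift m k)%N ==>
     ((j \in asms (rshift m k)) ==
        [exists i in nz lam, (j <= i < rshift m k)%N && (j \in asms i)])] =
   [forall j in asmS, (j < rshift m k)%N ==>
     ((j \in asms (rshift m k)) == (j \in \bigcup_(i in nz lam) asms i))].
  apply: eq_forallb_in => j _; congr (_ ==> (_ == _)).
  apply/exists_inP/bigcupP => -[i inz].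
    by case/andP; exists i.
  by move=> ji; exists i => //; rewrite bounded // lt_nz.
apply: asms_eqP => //.
  by apply/bigcupsP => i _; apply: asms_sub.
move=> j /bigcupP[i /lt_nz lt_ik /bounded le_ji].
exact: leq_ltn_trans le_ji lt_ik.
Qed.

Lemma phi_asm_uns k i1 l1 i2 l2 : rsn cert k = @Uns R d i1 l1 i2 l2 ->
  (i1 < rshift m k)%N -> (i2 < rshift m k)%N ->
  reflect (asms (rshift m k) = (asms i1 :\ l1) :|: (asms i2 :\ l2))
    (phi_asm cert k).
Proof.
move=> rk lt1 lt2; rewrite /phi_asm rk.
have -> : [forall j in asmS, (j < rshift m k)%N ==>
     ((j \in asms (rshift m k)) ==
        ((j \in asms i1) && (j != l1)) || ((j \in asms i2) && (j != l2)))] =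
   [forall j in asmS, (j < rshift m k)%N ==>
     ((j \in asms (rshift m k)) == (j \in (asms i1 :\ l1) :|: (asms i2 :\ l2)))].
  apply: eq_forallb_in => j _; rewrite !in_setU !in_setD1.
  by rewrite (andbC (j != l1)) (andbC (j != l2)).
apply: asms_eqP; rewrite ?rk //.
  by rewrite subUset !(subset_trans (subsetDl _ _)) // asms_sub.
move=> j; rewrite !in_setU !in_setD1.
case/orP => /andP[_ /bounded le_ji]; exact: leq_ltn_trans le_ji _.
Qed.

(** * Validity of derived constraints *)

Lemma valid_derP k : valid_der IP cert k <-> phi_der_at IP cert k.
Proof.
rewrite /valid_der /phi_der_at.
case rk: (rsn cert k) => [|lam|lam|i1 l1 i2 l2|].
- exact: rwP (phi_asm_asm rk).
- rewrite /phi_asm rk; split.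
    case=> lt_nz /lin_asms_eqP -> //; rewrite ?rk // => /lincomb_dominatesP ->.
    by rewrite andbT; apply/forall_inP.
  case/and3P => ha /forall_inP lt_nz /lincomb_dominatesP hd; split=> //.
  by apply/lin_asms_eqP; rewrite ?rk.
- rewrite /phi_asm rk; split.
    case=> lt_nz /lin_asms_eqP -> //; rewrite ?rk // => /rounding_dominatesP /= ->.
    by rewrite andbT; apply/forall_inP.
  case/and3P => ha /forall_inP lt_nz /rounding_dominatesP hd; split=> //.
  by apply/lin_asms_eqP; rewrite ?rk.
- split.
    case=> -[lt1 ltl1 lt2 ltl2] [/dominatesP d1 /dominatesP d2].
    move=> /split_disjunctionP hs /(phi_asm_uns rk lt1 lt2) ha.
    by rewrite ha lt1 lt2 ltl1 ltl2 d1 d2.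
  case/and5P => ha lt1 lt2 ltl1 /and4P[ltl2 /dominatesP d1 /dominatesP d2].
  move=> /split_disjunctionP hs; split=> //.
  exact/(phi_asm_uns rk).
- rewrite /sol_constr /pP; split.
    case=> /(phi_asm_sol rk) -> [x xs /dominatesP hx] /=.
    by case: (msense IP) hx => hx; apply/hasP; exists x.
  case/andP => /(phi_asm_sol rk) -> hx; split=> //.
  by case: (msense IP) hx => /hasP[x xs /dominatesP hx]; exists x.
Qed.

End Bounded.

(** The equivalence at one index relies on boundedness of all assumption sets. Each direction
    therefore first extracts boundedness from its own hypothesis, taken at every k. *)
Lemma valid_der_allP :
  (forall k, valid_der IP cert k) <-> [forall k, phi_der_at IP cert k].
Proof.
split=> [h | /forallP h].
  by apply/forallP => k; apply/(valid_derP (asms_bounded_valid h)).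
(* Whatever the reason, [phi_der_at] contains [phi_asm], which alone gives boundedness. *)
have hb : asms_bounded.
  apply: asms_bounded_phi => k; move: (h k); rewrite /phi_der_at.
  by case: (rsn cert k) => [|lam|lam|i1 l1 i2 l2|] // /andP[].
by move=> k; apply/(valid_derP hb).
Qed.

(** * The last constraint, the solution set and the assembly of the predicate *)

Lemma last_provesP (C : constr R n) :
  reflect (last_proves IP cert C) (phi_last IP cert C).
Proof.
apply: (iffP existsP) => -[k].
  by case/and3P => /eqP kd /dominatesP hd /asms_eq0P ha; exists k.
by case=> kd hd ha; exists k; rewrite kd eqxx /=; apply/andP; split;
  [apply/dominatesP | apply/asms_eq0P].
Qed.

Lemma satisfiesP (x : 'rV[R]_n) (C : constr R n) :
  reflect (satisfies x C)
    (((sg C >= 0) ==> (dot (coef C) x >= rhs C)) &&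
     ((sg C <= 0) ==> (dot (coef C) x <= rhs C))).
Proof.
case: C => a b [] /=; rewrite /satisfies /= ?andbT; try exact: idP.
by rewrite -eq_le eq_sym; apply: eqP.
Qed.

Lemma feasibleP :
  reflect (forall x, x \in sols cert -> feasible IP x) (phi_feas IP cert).
Proof.
apply: (iffP allP) => h x /h.
  case/andP => /forall_inP hi /forallP hc; split=> // i.
  exact/satisfiesP/hc.
case=> hi hc; apply/andP; split; first exact/forall_inP.
by apply/forallP => i; apply/satisfiesP/hc.
Qed.

Lemma sol_validP : sol_valid IP cert <-> phi_sol IP cert.
Proof.
rewrite /sol_valid /phi_sol /pR /pP /pPUB /pPLB /bU /bL /pPUB /pPLB.
case: (rtp cert) => [|lb ub lbN ubN] /=.
  rewrite cardfs_eq0; exact: rwP eqP.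
split.
  case=> /feasibleP -> /= hmin hmax.
  case: (msense IP) hmin hmax => hmin hmax; apply/implyP => hfin; rewrite hfin.
    case: (hmin erefl (elimN eqP hfin)) => x xs hx.
    (* [ubN] excludes -oo and [hfin] excludes +oo, so [ub] is real and the value 0 that [fine] gives
       to infinities never enters. *)
    by apply/hasP; exists x => //; case: ub ubN hfin hx {hmin}.
  case: (hmax erefl (elimN eqP hfin)) => x xs hx.
  by apply/hasP; exists x => //; case: lb lbN hfin hx {hmax}.
case/andP => /feasibleP hf hb; split=> // hs /eqP hfin; move: hb.
  rewrite hs hfin => /hasP[x xs hx]; exists x => //.
  by case: ub ubN hfin hx.
rewrite hs hfin => /hasP[x xs hx]; exists x => //.
by case: lb lbN hfin hx.
Qed.

(** Both sides already read the bound through [fine], and the guard selects that branch of [bL] or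
    [bU], so the bounds need no case analysis. *)
Lemma der_validP : der_valid IP cert <-> phi_der IP cert.
Proof.
rewrite /der_valid /phi_der /pR /pP /pPUB /pPLB /bU /bL /pPUB /pPLB.
case: (rtp cert) => [|lb ub lbN ubN] /=.
  split=> [[/valid_der_allP -> /last_provesP] // | /andP[]].
  by move=> /valid_der_allP hv /last_provesP.
split.
  case=> /valid_der_allP -> /= [hmin hmax].
  apply/andP; split; apply/implyP => /andP[hP hfin]; rewrite hfin.
    apply/last_provesP/hmin; last exact/eqP.
    by case: (msense IP) hP.
  apply/last_provesP/hmax; last exact/eqP.
  by case: (msense IP) hP.
case/and3P => /valid_der_allP hv hmin hmax; split=> //.
split=> hs /eqP hfin.
  by move: hmin; rewrite hs hfin => /last_provesP.
by move: hmax; rewrite hs hfin => /last_provesP.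
Qed.

End Correctness.

Theorem theorem1 (R : realType) (n m q : nat)
    (IP : milp R n m) (cert : certificate R n m q) :
  valid IP cert <-> phi IP cert = true.
Proof.
rewrite /valid /phi; split.
  by case=> /sol_validP -> /der_validP ->.
by case/andP => /sol_validP hs /der_validP hd.
Qed.
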